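(* Let $\mathbf A\in G^n$ be an element of type $(h,t)$ and let $\mathbf A=\mathbf A_1\mathbf A_2$ be its canonical decomposition. Then $M_{\mathbf A_1}^*\cup L(h,t)\cup V_{h+t}$ is a minimal generating set for the $\mathbb F_q$-algebra $R_{\mathbf A}$.
   Context: $\mathbb F_q$ is the finite field with $q$ elements, $q$ a power of a prime $p$; $\mathcal A_n=\mathbb F_q[x_1,\ldots,x_n]$, $n\ge1$; $\mathbb N$ contains $0$. $G\le \mathrm{GL}_2(\mathbb F_q)$ is the group of matrices $\begin{pmatrix}a&b\\0&1\end{pmatrix}$ with $a\ne0$, and $G^n$ is the direct product of $n$ copies. For $\mathbf A=(A_1,\ldots,A_n)\in G^n$, $A_i=\begin{pmatrix}a_i&b_i\\0&1\end{pmatrix}$, and $f\in\mathcal A_n$, $\mathbf A\circ f:=f(a_1x_1+b_1,\ldots,a_nx_n+b_n)$ and $R_{\mathbf A}:=\{f\in\mathcal A_n:\mathbf A\circ f=f\}$. An element of $G$ is of $h$-type if it equals $\begin{pmatrix}a&0\\0&1\end{pmatrix}$ with $a\neq0,1$, and of $t$-type if it equals $\begin{pmatrix}1&1\\0&1\end{pmatrix}$. For nonnegative integers $h,t$ with $h+t\le n$, $\mathbf A\in G^n$ is of type $(h,t)$ if its first $h$ coordinates are of $h$-type, the following $t$ are of $t$-type and the remaining $n-h-t$ are the identity matrix. The canonical decomposition $\mathbf A=\mathbf A_1\mathbf A_2$ is the one in which $\mathbf A_1=(A_1,\ldots,A_h,I,\ldots,I)$ (of type $(h,0)$) and $\mathbf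 A_2=\mathbf A_1^{-1}\mathbf A$. For $\mathbf B$ of type $(h,0)$ with $h\ge1$, let $a_i$ be the upper-left entry of its $i$-th coordinate ($1\le i\le h$) and $d_i=\mathrm{ord}(a_i)$ the multiplicative order. $M_{\mathbf B}$ is the set of monomials $x_1^{b_1}\cdots x_h^{b_h}$ with $(b_1,\ldots,b_h)\in\mathbb N^h$ nonzero, $b_i\le d_i$ for all $i$, and $a_1^{b_1}\cdots a_h^{b_h}=1$. $M_{\mathbf B}^*$ is the set of monomials in $M_{\mathbf B}$ not divisible by any other element of $M_{\mathbf B}$. If $h=0$, $M^*_{\mathbf B}=\emptyset$. $L(h,0)=\emptyset$, $L(h,1)=\{x_{h+1}^p-x_{h+1}\}$, and for $t\ge2$, $L(h,t)=\{x_{h+1}-x_{h+2},\ldots,x_{h+t-1}-x_{h+t},\,x_{h+t}^p-x_{h+t}\}$. $V_n=\emptyset$ and $V_d=\{x_{d+1},\ldots,x_n\}$ for $0\le d\le n-1$. A set $S$ of generators of an $\mathbb F_q$-algebra $R\subseteq\mathcal A_n$ is a minimal generating set if no proper subset of $S$ generates $R$ as an $\mathbb F_q$-algebra. *)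

(* Defs.v *)
From HB Require Import structures.
From mathcomp Require Import all_boot all_order all_algebra all_fingroup.
From mathcomp Require Import mpoly.

Set Implicit Arguments.
Unset Strict Implicit.
Unset Printing Implicit Defensive.

Import GroupScope GRing.Theory.
Local Open Scope ring_scope.

(* Subsets of an algebra are Prop-valued predicates throughout, so that no
   decidability of membership is required. *)

Section GeneratedAlgebra.

Variables (K : fieldType) (A : algType K).

Inductive subalg_gen (S : A -> Prop) : A -> Prop :=
| SubalgGen s : S s -> subalg_gen S s
| SubalgScalar c : subalg_gen S c%:A
| SubalgAdd f g : subalg_gen S f -> subalg_gen S g -> subalg_gen S (f + g)
| SubalgMul f g : subalg_gen S f -> subalg_gen S g -> subalg_gen S (f * g).

Definition generates (S R : A -> Prop) : Prop :=
  forall f, R f <-> subalg_gen S f.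

Definition proper_subset (T S : A -> Prop) : Prop :=
  (forall f, T f -> S f) /\ (exists2 s, S s & ~ T s).

Definition minimal_generating_set (S R : A -> Prop) : Prop :=
  generates S R /\ (forall T, proper_subset T S -> ~ generates T R).

End GeneratedAlgebra.

Section AffineGroup.

Variable F : finFieldType.

(* The condition a != 0 is automatic for an invertible matrix. *)
Definition aff : {set {'GL_2[F]}} :=
  [set M : {'GL_2[F]} | (M 1 0 == 0) && (M 1 1 == 1)].

Lemma aff_group_set : group_set aff.
Proof.
apply/group_setP; split=> [|M N]; first by rewrite inE GL_1E !mxE !eqxx.
rewrite !inE => /andP[/eqP M0 /eqP M1] /andP[/eqP N0 /eqP N1].
have e0 : lift ord0 ord0 = 1 :> 'I_2 by exact/val_inj.
rewrite GL_MxE !mxE !big_ord_recl !big_ord0 /= !e0.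
have -> : (ord0 : 'I_2) = 0 by [].
by rewrite M0 M1 N0 N1 !(mul0r, mul1r, addr0, add0r) !eqxx.
Qed.

Canonical aff_group := Group aff_group_set.

Definition h_type (M : {'GL_2[F]}) : Prop :=
  [/\ M \in aff, M 0 1 = 0 & M 0 0 != 1].

Definition t_type (M : {'GL_2[F]}) : Prop :=
  [/\ M \in aff, M 0 0 = 1 & M 0 1 = 1].

(* The multiplicative order of a != 0; zero gets the junk value 1. *)
Definition mulord (a : F) : nat := #[insubd (1%g : {unit F}) a]%g.

End AffineGroup.

Section Invariants.

Variables (F : finFieldType) (n : nat).

(* The ambient group of all n-tuples over GL_2(F), with the componentwise
   product; G^n is its subgroup affn. *)
Local Notation GL2n := {dffun 'I_n -> {'GL_2[F]}}.

Definition affn : {set GL2n} := setXn (fun _ : 'I_n => aff F).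

Definition subst_act (A : GL2n) (f : {mpoly F[n]}) : {mpoly F[n]} :=
  f \mPo [tuple A i 0 0 *: 'X_i + (A i 0 1)%:MP | i < n].

Definition invariant_ring (A : GL2n) (f : {mpoly F[n]}) : Prop :=
  subst_act A f = f.

(* Indices start at 0: the variable x_k of the text is 'X_(k-1) here. *)
Definition of_type (h t : nat) (A : GL2n) : Prop :=
  [/\ (h + t <= n)%N,
      forall i : 'I_n, (i < h)%N -> h_type (A i),
      forall i : 'I_n, (h <= i < h + t)%N -> t_type (A i)
    & forall i : 'I_n, (h + t <= i)%N -> A i = 1%g].

Definition canonical_decomposition (h : nat) (A A1 A2 : GL2n) : Prop :=
  A1 = [ffun i : 'I_n => if (i < h)%N then A i else 1%g]
  /\ A2 = (A1^-1 * A)%g.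

(* For h = 0 this is empty, since then m = 0. *)
Definition Mset (h : nat) (B : GL2n) (f : {mpoly F[n]}) : Prop :=
  exists m : 'X_{1..n},
    [/\ f = 'X_[m],
        m != 0%MM,
        forall i : 'I_n, (h <= i)%N -> m i = 0%N,
        forall i : 'I_n, (i < h)%N -> (m i <= mulord (B i 0%R 0%R))%N
      & \prod_(i < n | (i < h)%N) (B i 0 0) ^+ m i = 1].

Definition Mstar (h : nat) (B : GL2n) (f : {mpoly F[n]}) : Prop :=
  Mset h B f /\
  (forall g, Mset h B g -> (exists k, f = k * g) -> g = f).

(* For t = 1 no index satisfies the first disjunct; for t = 0 neither
   disjunct can hold. *)
Definition Lset (p h t : nat) (f : {mpoly F[n]}) : Prop :=
  (exists i j : 'I_n,
     [/\ (h <= i)%N, j = i.+1 :> nat, (j < h + t)%N & f = 'X_i - 'X_j])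
  \/ (exists i : 'I_n,
     [/\ (0 < t)%N, i.+1 = (h + t)%N & f = 'X_i ^+ p - 'X_i]).

Definition Vset (d : nat) (f : {mpoly F[n]}) : Prop :=
  exists2 i : 'I_n, (d <= i)%N & f = 'X_i.

End Invariants.

(* Main.v *)
(* Generation: let m be the leading monomial, for the degree-lexicographic order, of an
   invariant f. Comparing coefficients in A o f = f shows that the part of m in
   x_1, ..., x_h is fixed by A_1 and that p divides the exponent of x_(h+t). Hence m is the
   leading monomial of a product of the proposed generators, and subtracting a multiple of
   that product lowers the leading monomial of f.

   Irredundance: if a monomial m is not a product of two nonconstant monomials that can
   occur in elements of the subalgebra, then D f := f@_m satisfies the Leibniz rule
   D (f g) = f(0) D g + D f g(0) there, so D vanishes on the algebra generated by T as soon
   as it vanishes on T. Each generator s is separated in this way from all the others: by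
   its own coefficient if s is in M*, by a sum of coefficients of linear monomials
   otherwise. *)
Require Import Defs.
From mathcomp Require Import all_boot all_order all_algebra all_fingroup.
From mathcomp Require Import mpoly ring zify.

Set Implicit Arguments.
Unset Strict Implicit.
Unset Printing Implicit Defensive.

Import Order.TTheory GRing.Theory.
Local Open Scope ring_scope.

(** * Generated subalgebras and coefficients under affine substitution *)

Lemma subalg_genZ (K : fieldType) (A : algType K) (S : A -> Prop) c f :
  subalg_gen S f -> subalg_gen S (c *: f).
Proof.
by move=> Sf; rewrite -mulr_algl; apply: SubalgMul Sf; apply: SubalgScalar.
Qed.

Lemma subalg_genS (K : fieldType) (A : algType K) (S T : A -> Prop) f :
  (forall g, S g -> T g) -> subalg_gen S f -> subalg_gen T f.
Proof.
move=> sST; elim=> {f} [s /sST | c | f g _ Tf _ Tg | f g _ Tf _ Tg].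
- exact: SubalgGen.
- exact: SubalgScalar.
- exact: SubalgAdd.
- exact: SubalgMul.
Qed.

(** The variables are substituted independently, so the coefficient is a product of one-variable
    binomial coefficients of [(a i X + b i) ^ v i]. If [u i] exceeds [v i], the binomial is zero and
    the truncated subtraction is harmless. *)
Lemma mcoeff_affine_comp (R : comNzRingType) (n : nat) (a b : 'I_n -> R)
    (v u : 'X_{1..n}) :
  ('X_[v] \mPo [tuple a i *: 'X_i + (b i)%:MP | i < n])@_u =
  \prod_(i < n) ('C(v i, u i)%:R * a i ^+ u i * b i ^+ (v i - u i)).
Proof.
pose c i j := 'C(v i, j)%:R * a i ^+ j * b i ^+ (v i - j).
(* [N] exceeds every exponent of [v] and [u], so all the binomial expansions can share the index
   type ['I_N] and the product of sums becomes a sum over functions, of which only [i |-> u i]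
   contributes. *)
pose N := (mdeg v + mdeg u).+1.
have le_deg (w : 'X_{1..n}) i : (w i <= mdeg w)%N.
  by rewrite mdegE (bigD1 i) //= leq_addr.
have vN i : (v i < N)%N by rewrite ltnS (leq_trans (le_deg v i)) ?leq_addr.
have uN i : (u i < N)%N by rewrite ltnS (leq_trans (le_deg u i)) ?leq_addl.
rewrite comp_mpolyX (eq_bigr (fun i => \sum_(j < N) c i j *: 'X_i ^+ j)).
  rewrite bigA_distr_bigA raddf_sum.
  have prodE (f : {ffun 'I_n -> 'I_N}) :
      (\prod_i (c i (f i) *: 'X_i ^+ f i))@_u =
      (\prod_i c i (f i)) * ([multinom (f i : nat) | i < n] == u)%:R.
    rewrite scaler_prod mcoeffZ -mcoeffX mpolyXE_id; congr (_ * _@__).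
    by apply: eq_bigr => i _; rewrite mnmE.
  transitivity (\sum_(f : {ffun 'I_n -> 'I_N}) (\prod_i c i (f i)) *
      ([multinom (f i : nat) | i < n] == u)%:R).
    by apply: eq_bigr => f _; apply: prodE.
  rewrite (bigD1 [ffun i => Ordinal (uN i)]) //= [X in _ + X]big1 ?addr0.
    set w := [multinom _ | _ < _].
    have -> : w = u by apply/mnmP=> i; rewrite mnmE ffunE.
    by rewrite eqxx mulr1; apply: eq_bigr => i _; rewrite ffunE.
  move=> f nfu; case: eqP => [fu|_]; last by rewrite mulr0.
  case/eqP: nfu; apply/ffunP=> i; apply/val_inj; rewrite ffunE /=.
  by rewrite -fu mnmE.
move=> i _; rewrite tnth_mktuple addrC exprDn.
rewrite (big_ord_widen N (fun j => ((b i)%:MP ^+ (v i - j) *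
  (a i *: 'X_i) ^+ j) *+ 'C(v i, j))) //.
rewrite big_mkcond; apply: eq_bigr => j _; rewrite ltnS.
case: leqP => [jv|vj]; last by rewrite /c bin_small // !mul0r scale0r.
rewrite exprZn -rmorphXn mul_mpolyC scalerA -scaler_nat scalerA /c.
by congr (_ *: _); rewrite -mulrA [a i ^+ _ * _]mulrC.
Qed.

(** * Indecomposable monomials and the Leibniz rule *)

(* Splitting off the constant terms leaves only the products of two nonzero monomials. *)
Lemma mcoeffM_indecomposable (R : comNzRingType) (n : nat) (f g : {mpoly R[n]})
    (m : 'X_{1..n}) :
  m != 0%MM ->
  (forall u v, m = (u + v)%MM -> f@_u != 0 -> g@_v != 0 ->
     u = 0%MM \/ v = 0%MM) ->
  (f * g)@_m = f@_0%MM * g@_m + f@_m * g@_0%MM.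
Proof.
move=> m_neq0 indec.
pose f' := f - (f@_0%MM)%:MP; pose g' := g - (g@_0%MM)%:MP.
have -> : f * g = f' * g' + f@_0%MM *: g + g@_0%MM *: f - (f@_0%MM * g@_0%MM)%:MP.
  by rewrite /f' /g' -!mul_mpolyC rmorphM /=; ring.
rewrite !(mcoeffB, mcoeffD, mcoeffZ, mcoeffC) (negPf m_neq0).
rewrite mulr0 subr0 [g@_0%MM * _]mulrC; suff -> : (f' * g')@_m = 0 by rewrite add0r.
have coefB (h : {mpoly R[n]}) w :
    (h - (h@_0%MM)%:MP)@_w = if w == 0%MM then 0 else h@_w.
  by rewrite mcoeffB mcoeffC; case: eqP => [->|_]; rewrite ?mulr1 ?subrr ?mulr0 ?subr0.
rewrite mcoeffM big1 // => k /eqP mk; rewrite !coefB.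
case: eqP => [|/eqP u0]; first by rewrite mul0r.
case: eqP => [|/eqP v0]; first by rewrite mulr0.
have [->|fu] := eqVneq f@_(k.1) 0; first by rewrite mul0r.
have [->|gv] := eqVneq g@_(k.2) 0; first by rewrite mulr0.
by case: (indec _ _ mk fu gv) => /eqP; rewrite ?(negPf u0) ?(negPf v0).
Qed.
(** At each [m i] the Leibniz rule holds for polynomials supported in [Q], so the sum of these
    coefficients vanishes on products once it vanishes on the factors. The support condition travels
    through the same induction because [Q] is a submonoid. *)
Lemma subalg_gen_indecomposable (K : fieldType) (n : nat)
    (T : {mpoly K[n]} -> Prop) (Q : pred 'X_{1..n})
    (I : Type) (r : seq I) (P : pred I) (m : I -> 'X_{1..n}) :
  Q 0%MM -> (forall u v, Q u -> Q v -> Q (u + v)%MM) ->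
  (forall i, P i -> m i != 0%MM) ->
  (forall i u v, P i -> m i = (u + v)%MM -> Q u -> Q v ->
     u = 0%MM \/ v = 0%MM) ->
  (forall g, T g -> (forall u, g@_u != 0 -> Q u) /\
     \sum_(i <- r | P i) g@_(m i) = 0) ->
  forall f, subalg_gen T f ->
    (forall u, f@_u != 0 -> Q u) /\ \sum_(i <- r | P i) f@_(m i) = 0.
Proof.
move=> Q0 QD m_neq0 indec QT f.
elim=> {f} [g /QT // | c | f g _ [Qf f0] _ [Qg g0] | f g _ [Qf f0] _ [Qg g0]].
- rewrite alg_mpolyC; split=> [u | ].
    rewrite mcoeffC; by case: (eqVneq u 0%MM) => [-> // | _]; rewrite mulr0 eqxx.
  by rewrite big1 // => i /m_neq0/negPf mi; rewrite mcoeffC mi mulr0.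
- split=> [u|].
    rewrite mcoeffD; have [fu|/Qf //] := eqVneq f@_u 0.
    by rewrite fu add0r => /Qg.
  under eq_bigr do rewrite mcoeffD.
  by rewrite big_split /= f0 g0 addr0.
- split=> [u|].
    apply: contraR => NQu; rewrite mcoeffM big1 // => k /eqP uk.
    have [->|/Qf Qk1] := eqVneq f@_(k.1) 0; first by rewrite mul0r.
    have [->|/Qg Qk2] := eqVneq g@_(k.2) 0; first by rewrite mulr0.
    by case/negP: NQu; move: (QD _ _ Qk1 Qk2); rewrite -uk.
  rewrite (eq_bigr (fun i => f@_0%MM * g@_(m i) + f@_(m i) * g@_0%MM)).
    by rewrite big_split /= -mulr_sumr -mulr_suml f0 g0 mulr0 mul0r addr0.
  move=> i Pi; apply: mcoeffM_indecomposable; first exact: m_neq0.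
  by move=> u v muv /Qf Qu /Qg Qv; apply: indec muv Qu Qv.
Qed.

(** * Monomials fixed by the diagonal part *)

Definition supported (n h : nat) (m : 'X_{1..n}) : bool :=
  [forall i : 'I_n, (h <= i)%N ==> (m i == 0%N)].

(** This is the eigenvalue of the monomial under the scaling of [x_i] by [a i] for [i < h]. *)
Definition character (F : finFieldType) (n h : nat) (a : 'I_n -> F)
    (m : 'X_{1..n}) : F := \prod_(i < n | (i < h)%N) a i ^+ m i.

Lemma supportedP (n h : nat) (m : 'X_{1..n}) :
  reflect (forall i : 'I_n, (h <= i)%N -> m i = 0%N) (supported h m).
Proof. by apply: (iffP 'forall_implyP) => hm i /hm/eqP. Qed.

Lemma supportedD (n h : nat) (u v : 'X_{1..n}) :
  supported h (u + v)%MM = supported h u && supported h v.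
Proof.
apply/supportedP/andP=> [uv | [/supportedP hu /supportedP hv] i hi].
  split; apply/supportedP=> i /uv /eqP;
  by rewrite mnmDE addn_eq0 => /andP[/eqP ? /eqP ?].
by rewrite mnmDE hu ?hv.
Qed.

Lemma character0 (F : finFieldType) (n h : nat) (a : 'I_n -> F) :
  character h a 0%MM = 1.
Proof. by apply: big1 => i _; rewrite mnm0E expr0. Qed.

Lemma characterD (F : finFieldType) (n h : nat) (a : 'I_n -> F)
    (u v : 'X_{1..n}) :
  character h a (u + v)%MM = character h a u * character h a v.
Proof. by rewrite -big_split; apply: eq_bigr => i _; rewrite mnmDE exprD. Qed.

Lemma mulord_gt0 (F : finFieldType) (a : F) : (0 < mulord a)%N.
Proof. exact: order_gt0. Qed.

Lemma expr_mulord (F : finFieldType) (a : F) : a != 0 -> a ^+ mulord a = 1.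
Proof.
move=> a_neq0; have Ua : a \is a GRing.unit by rewrite unitfE.
rewrite /mulord -{1}(insubdK (1%g : {unit F}) Ua : val _ = a) -FinRing.val_unitX.
by rewrite expg_order FinRing.val_unit1.
Qed.

Lemma mpolyX_inj (R : nzRingType) (n : nat) :
  injective (fun m : 'X_{1..n} => 'X_[m] : {mpoly R[n]}).
Proof.
move=> m u /(congr1 (mcoeff u)); rewrite !mcoeffX eqxx.
by case: eqP => // _ /esym/eqP; rewrite oner_eq0.
Qed.

Lemma Mset_mpolyX (F : finFieldType) (n h : nat)
    (B : {dffun 'I_n -> {'GL_2[F]}}) (m : 'X_{1..n}) :
  Mset h B 'X_[m] <->
  [/\ m != 0%MM, supported h m,
      forall i : 'I_n, (i < h)%N -> (m i <= mulord (B i 0%R 0%R))%N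
    & character h (fun i => B i 0 0) m = 1].
Proof.
split=> [[m' [/mpolyX_inj <- m0 hm dm wm]] | [m0 /supportedP hm dm wm]].
  by split=> //; apply/supportedP.
by exists m.
Qed.

Lemma mpolyX_dvd (R : comNzRingType) (n : nat) (m u : 'X_{1..n}) :
  (exists k : {mpoly R[n]}, 'X_[m] = k * 'X_[u]) <-> (u <= m)%MM.
Proof.
split=> [[k /(congr1 (mcoeff m))] | um].
  rewrite mcoeffX eqxx mcoeffM; apply: contra_eqT => num.
  rewrite big1 ?oner_neq0 // => v /eqP mv; rewrite mcoeffX.
  case: eqP => [uv | _]; last by rewrite mulr0.
  by case/negP: num; move: (lem_addl v.1 v.2); rewrite -mv -uv.
by exists 'X_[m - u]; rewrite -mpolyXD submK.
Qed.

(* A nonconstant invariant monomial is minimal under divisibility or splits into two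
   invariant monomials of smaller degree; minimal ones satisfy the bounds [m i <= d_i],
   since [x_i ^+ d_i] is invariant. *)
Lemma Mstar_generates (F : finFieldType) (n h : nat)
    (B : {dffun 'I_n -> {'GL_2[F]}}) (m : 'X_{1..n}) :
  (forall i : 'I_n, (i < h)%N -> B i 0 0 != 0) ->
  supported h m -> character h (fun i => B i 0 0) m = 1 ->
  subalg_gen (Mstar h B) 'X_[m].
Proof.
move=> B_neq0; set chi := character h _.
have [d] := ubnP (mdeg m); elim: d m => // d IHd m md hm chim.
have [->|m_neq0] := eqVneq m 0%MM.
  by rewrite mpolyX0 -[1]scale1r; apply: SubalgScalar.
have chiB u : (u <= m)%MM -> chi u = 1 -> chi (m - u)%MM = 1.
  by move=> um chiu; move: chim; rewrite -{1}(submK um) /chi characterD -/chi chiu mulr1.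
(* Bounding the degree makes the candidate divisors a finite type, so the existence of a proper
   invariant divisor is decidable. *)
pose divisor (u : 'X_{1..n < (mdeg m).+1}) :=
  [&& (u <= m)%MM, bmnm u != 0%MM, bmnm u != m & chi u == 1].
have [/existsP[[u ud] /and4P/=[um u0 unm /eqP chiu]] | nodiv] := boolP [exists u, divisor u].
  have mE := submK um.
  have : supported h (m - u + u)%MM by rewrite mE.
  rewrite supportedD => /andP[hmu hu].
  have mu0 : (m - u)%MM != 0%MM.
    by apply: contraNneq unm => mu0; rewrite -mE mu0 add0m.
  have degE : (mdeg (m - u) + mdeg u = mdeg m)%N by rewrite -mdegD mE.
  have chimu := chiB _ um chiu; rewrite -mE mpolyXD.
  by apply: SubalgMul; apply: IHd => //; move: u0 mu0 degE md;
    rewrite -!mdeg_eq0; lia.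
(* Without a proper invariant divisor, [m] itself has to be in [Mstar]: this gives its minimality
   and, applied to a power of a single variable, the bounds on its exponents. *)
have minm u : (u <= m)%MM -> u != 0%MM -> chi u = 1 -> u = m.
  move=> um u0 chiu; apply/eqP; apply: contraNT nodiv => unm; apply/existsP.
  have ud : (mdeg u < (mdeg m).+1)%N by rewrite ltnS lemc_mdeg ?lem_leo.
  by exists (BMultinom ud); apply/and4P; split=> //=; apply/eqP.
apply: SubalgGen; split.
  apply/Mset_mpolyX; split=> // i ih; rewrite leqNgt; apply/negP=> di.
  pose u := (U_(i) *+ mulord (B i 0%R 0%R))%MM.
  have uE j : u j = if j == i then mulord (B i 0 0) else 0%N.
    by rewrite mulmnE mnm1E eq_sym; case: eqP => _; rewrite ?mul1n ?mul0n.
  have /minm um : (u <= m)%MM.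
    by apply/mnm_lepP=> j; rewrite uE; case: eqP => [->|//]; apply: ltnW.
  suff /mnmP/(_ i) : u = m by rewrite uE eqxx => miE; rewrite miE ltnn in di.
  apply: um.
    apply/eqP=> /mnmP/(_ i); rewrite uE eqxx mnm0E => d0.
    by have := mulord_gt0 (B i 0 0); rewrite d0.
  rewrite /chi /character (bigD1 i) //= uE eqxx expr_mulord ?B_neq0 // mul1r.
  by apply: big1 => j /andP[_ /negPf ji]; rewrite uE ji expr0.
move=> g [u [-> u0 hu _ chiu]] /mpolyX_dvd um; congr 'X_[_]; exact: minm.
Qed.

(** * Leading monomials of invariants *)

(** Writing a coefficient as a sum over the support allows a termwise comparison with the
    coefficients of a substituted polynomial. *)
Lemma sum_msupp (R : nzRingType) (n : nat) (f : {mpoly R[n]}) (u : 'X_{1..n}) :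
  \sum_(v <- msupp f) f@_v * (v == u)%:R = f@_u.
Proof.
rewrite [RHS](congr1 (mcoeff u) (mpolyE f)) raddf_sum.
by apply: eq_bigr => v _; rewrite /= mcoeffZ mcoeffX.
Qed.

(** Substitution only lowers exponents, and only those of translated variables: otherwise a binomial
    coefficient or a power of [b i = 0] kills the product. *)
Lemma mcoeff_affine_comp_neq0 (R : comNzRingType) (n : nat) (a b : 'I_n -> R)
    (v u : 'X_{1..n}) :
  ('X_[v] \mPo [tuple a i *: 'X_i + (b i)%:MP | i < n])@_u != 0 ->
  (u <= v)%MM /\ forall i, b i = 0 -> v i = u i.
Proof.
rewrite mcoeff_affine_comp => prod_neq0.
have fac_neq0 i : 'C(v i, u i)%:R * a i ^+ u i * b i ^+ (v i - u i) != 0.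
  by apply: contraNneq prod_neq0 => fi; rewrite (bigD1 i) //= fi mul0r.
have uv i : (u i <= v i)%N.
  rewrite leqNgt; apply: contra (fac_neq0 i) => vu.
  by rewrite bin_small // !mul0r.
split=> [|i bi]; first exact/mnm_lepP.
apply/eqP; rewrite eqn_leq uv andbT -subn_eq0.
by apply: contraNT (fac_neq0 i) => vu; rewrite bi expr0n (negPf vu) mulr0.
Qed.

Lemma mcoeff_affine_comp_diag (F : finFieldType) (n h : nat) (a b : 'I_n -> F)
    (m : 'X_{1..n}) :
  (forall i : 'I_n, (h <= i)%N -> a i = 1) ->
  ('X_[m] \mPo [tuple a i *: 'X_i + (b i)%:MP | i < n])@_m = character h a m.
Proof.
move=> a1; rewrite mcoeff_affine_comp [RHS]big_mkcond; apply: eq_bigr => i _.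
rewrite binn subnn expr0 mulr1 mul1r.
by case: ltnP => // /a1 ->; rewrite expr1n.
Qed.

Lemma mcoeff_comp_mpoly (R : comNzRingType) (n k : nat)
    (lq : n.-tuple {mpoly R[k]}) (f : {mpoly R[n]}) (u : 'X_{1..k}) :
  (f \mPo lq)@_u = \sum_(v <- msupp f) f@_v * ('X_[v] \mPo lq)@_u.
Proof.
rewrite comp_mpolyEX raddf_sum.
by apply: eq_bigr => v _; rewrite /= mcoeffZ.
Qed.

(** Since substitution never raises a monomial, the coefficient of the result at the leading
    monomial comes from that monomial alone, multiplied by its character. *)
Lemma invariant_mlead_character (F : finFieldType) (n h : nat)
    (a b : 'I_n -> F) (f : {mpoly F[n]}) :
  (forall i : 'I_n, (h <= i)%N -> a i = 1) ->
  f \mPo [tuple a i *: 'X_i + (b i)%:MP | i < n] = f -> f != 0 ->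
  character h a (mlead f) = 1.
Proof.
move=> a1 inv_f f_neq0; set m := mlead f.
have fm_neq0 : f@_m != 0 by rewrite mleadc_eq0.
apply: (mulfI fm_neq0); rewrite mulr1 -[RHS](congr1 (mcoeff m) inv_f).
rewrite mcoeff_comp_mpoly -[X in X * _](sum_msupp f m) mulr_suml.
apply: eq_big_seq => v fv; rewrite -mulrA; congr (_ * _).
have [-> | vm] := eqVneq v m; first by rewrite mul1r (mcoeff_affine_comp_diag _ _ a1).
rewrite mul0r; apply/esym/eqP; apply: contraNT vm.
case/mcoeff_affine_comp_neq0=> /lem_leo mv _.
by rewrite eq_le mv msupp_le_mlead.
Qed.

(* Comparing the coefficients at [m - U_(k)], where [m] is the leading monomial: since
   [k] is the smallest variable that is translated, only [m] and [m - U_(k)] contribute,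
   and the former contributes [m k] times the leading coefficient. *)
Lemma invariant_mlead_dvd (F : finFieldType) (p n h : nat)
    (a b : 'I_n -> F) (k : 'I_n) (f : {mpoly F[n]}) :
  p \in [pchar F] ->
  (forall i : 'I_n, (h <= i)%N -> a i = 1) -> (h <= k)%N ->
  b k = 1 -> (forall i : 'I_n, (k < i)%N -> b i = 0) ->
  f \mPo [tuple a i *: 'X_i + (b i)%:MP | i < n] = f -> f != 0 ->
  (p %| mlead f k)%N.
Proof.
move=> pF a1 hk bk b0 inv_f f_neq0; set m := mlead f.
have fm_neq0 : f@_m != 0 by rewrite mleadc_eq0.
have chim := invariant_mlead_character a1 inv_f f_neq0; rewrite -/m in chim.
have [->|mk_gt0] := posnP (m k); first exact: dvdn0.
have Ukm : (U_(k) <= m)%MM.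
  by apply/mnm_lepP=> i; rewrite mnm1E; case: eqP => // <-.
pose u := (m - U_(k))%MM.
have mE : m = (u + U_(k))%MM by rewrite submK.
have chiu : character h a u = 1.
  move: chim; rewrite mE characterD.
  suff -> : character h a U_(k) = 1 by rewrite mulr1.
  by apply: big1 => i ih; rewrite mnm1E; case: eqP => [ki|_] //; move: ih hk; rewrite ki; lia.
rewrite (dvdn_pcharf pF).
(* The last summand is the contribution of [u] itself, whose character is 1; cancelling it leaves
   [m k = 0] in [F]. *)
suff fuE : f@_u = f@_m * (m k)%:R + f@_u.
  have /eqP : f@_m * (m k)%:R = 0 by apply: (addIr f@_u); rewrite add0r.
  by rewrite mulf_eq0 (negPf fm_neq0).
rewrite -{1}[f@_u](congr1 (mcoeff u) inv_f) mcoeff_comp_mpoly.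
rewrite -(sum_msupp f m) -(sum_msupp f u) mulr_suml -big_split.
apply: eq_big_seq => v fv /=; rewrite -mulrA -mulrDr; congr (_ * _).
have num : u != m.
  by apply/eqP=> um; have := congr1 mdeg mE; rewrite mdegD mdeg1 um; lia.
have [-> | vm] := eqVneq v m.
  rewrite eq_sym (negPf num) addr0 mul1r mcoeff_affine_comp (bigD1 k) //=.
  have -> : u k = (m k).-1 by rewrite mnmBE mnm1E eqxx subn1.
  rewrite -{1 3}(prednK mk_gt0) binSn a1 // bk !expr1n !mulr1 prednK //.
  rewrite -[RHS]mulr1 -[X in _ = _ * X]chim; congr (_ * _).
  rewrite /character big_mkcond [RHS]big_mkcond /=; apply: eq_bigr => i _.
  have [-> | ik] := eqVneq i k; first by rewrite ltnNge hk.
  have -> : u i = m i by rewrite mnmBE mnm1E eq_sym (negPf ik) subn0.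
  rewrite binn subnn expr0 mulr1 mul1r.
  by case: ltnP => // /a1 ->; rewrite expr1n.
have [-> | vu] := eqVneq v u.
  by rewrite (mcoeff_affine_comp_diag _ _ a1) chiu mul0r add0r.
rewrite mul0r addr0; apply/eqP; apply: contraNT vm.
case/mcoeff_affine_comp_neq0=> uv vb.
have vE : v = (v - u + u)%MM by rewrite submK.
have v_le_m := msupp_le_mlead fv; rewrite -/m in v_le_m.
(* The order compares degrees first, so [v] has degree at most that of [m], which is one more than
   that of [u]; as [v] is a proper multiple of [u], it is [u] times a single variable [x_j]. *)
have /mdeg1P[j /eqP vuj] : mdeg (v - u)%MM == 1%N.
  have := lemc_mdeg v_le_m; rewrite {1}vE mE !mdegD mdeg1 => dv.
  have : mdeg (v - u)%MM != 0%N.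
    by rewrite mdeg_eq0; apply: contraNneq vu => vu0; rewrite vE vu0 add0m.
  lia.
rewrite vuj addmC in vE.
have vuE i : v i = (u i + (j == i))%N by rewrite vE mnmDE mnm1E.
(* For [j > k] the variable [x_j] is not translated and cannot lose a factor. For [j <= k] the order
   has [x_j >= x_k], hence [v >= m], and [v] equals [m]. *)
have [kj | jk] := ltnP k j.
  by have := vb _ (b0 _ kj); rewrite vuE eqxx; lia.
suff -> : v = m by [].
apply/le_anti; rewrite v_le_m mE vE lemc_add2r /=.
rewrite leNgt; apply/negP=> /ltmcP; rewrite !mdeg1 => /(_ erefl)[i lti].
rewrite !mnm1E; case: eqP => // ji; case: eqP => // ki _; subst i.
have jk' : (j < k)%N by rewrite ltn_neqAle jk andbT; apply: contra_notN ji => /eqP /val_inj.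
by move: (lti j jk'); rewrite !mnm1E eqxx; case: eqP => // kj; case: ji.
Qed.

(** * Leading monomials attained by the generated algebra *)

(** These exponents form a submonoid, so they need only be found for the generators. Leading
    coefficient 1 lets a scalar multiple cancel any given leading term. *)
Definition monic_lead (F : fieldType) (n : nat) (S : {mpoly F[n]} -> Prop)
    (m : 'X_{1..n}) : Prop :=
  exists2 f, subalg_gen S f & mlead f = m /\ f@_m = 1.

Lemma monic_leadD (F : fieldType) (n : nat) (S : {mpoly F[n]} -> Prop)
    (u v : 'X_{1..n}) :
  monic_lead S u -> monic_lead S v -> monic_lead S (u + v)%MM.
Proof.
move=> [f Sf [fu f1]] [g Sg [gv g1]]; exists (f * g); first exact: SubalgMul.
have nz (q : {mpoly F[n]}) w : q@_w = 1 -> q != 0.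
  by move=> q1; apply: contra_eq_neq q1 => ->; rewrite mcoeff0 eq_sym oner_neq0.
rewrite mleadM ?(nz _ _ f1) ?(nz _ _ g1) // fu gv; split=> //.
by rewrite -fu -gv mleadcM fu gv f1 g1 mulr1.
Qed.

Lemma monic_lead0 (F : fieldType) (n : nat) (S : {mpoly F[n]} -> Prop) :
  monic_lead S 0%MM.
Proof.
exists 1; last by rewrite mlead1 mcoeff1 eqxx.
by rewrite -[1]scale1r; apply: SubalgScalar.
Qed.

Lemma monic_leadMn (F : fieldType) (n : nat) (S : {mpoly F[n]} -> Prop)
    (u : 'X_{1..n}) k :
  monic_lead S u -> monic_lead S (u *+ k)%MM.
Proof.
move=> Su; elim: k => [|k IHk]; first by rewrite mulm0n; apply: monic_lead0.
by rewrite mulmS; apply: monic_leadD.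
Qed.

Lemma monic_lead_sub (F : fieldType) (n : nat) (S : {mpoly F[n]} -> Prop)
    (u v : 'X_{1..n}) :
  (v < u)%O -> S ('X_[u] - 'X_[v]) -> monic_lead S u.
Proof.
move=> vu Suv; exists ('X_[u] - 'X_[v]); first exact: SubalgGen.
split; first by rewrite mleadDl ?mleadN ?mleadXm.
by rewrite mcoeffB !mcoeffX eqxx lt_eqF // subr0.
Qed.

Definition candidate (F : finFieldType) (p n h t : nat)
    (B : {dffun 'I_n -> {'GL_2[F]}}) (f : {mpoly F[n]}) : Prop :=
  Mstar h B f \/ Lset p h t f \/ Vset (h + t) f.

(** The part of [m] in the first [h] variables is a product of elements of [Mstar]. Each remaining
    variable is handled alone: [x_i] leads [x_i - x_(i+1)] inside the translated block, [x_i ^ p]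
    leads the generator at the end of the block, and [x_i] is itself a generator beyond it. *)
Lemma candidate_monic_lead (F : finFieldType) (p n h t : nat)
    (B : {dffun 'I_n -> {'GL_2[F]}}) (m : 'X_{1..n}) :
  (1 < p)%N -> (h + t <= n)%N ->
  (forall i : 'I_n, (i < h)%N -> B i 0 0 != 0) ->
  character h (fun i => B i 0 0) m = 1 ->
  (forall k : 'I_n, (h <= k)%N -> k.+1 = (h + t)%N -> (p %| m k)%N) ->
  monic_lead (candidate p h t B) m.
Proof.
move=> p_gt1 htn B_neq0 chim pm.
pose m0 := [multinom (if (i < h)%N then m i else 0%N) | i < n].
have -> : m = (m0 + \sum_(i < n | (h <= i)%N) U_(i) *+ m i)%MM.
  apply/mnmP=> j; rewrite mnmDE mnm_sumE mnmE.
  rewrite (eq_bigr (fun i : 'I_n => if i == j then m j else 0%N)); last first.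
    by move=> i _; rewrite mulmnE mnm1E; case: eqP => [->|_]; rewrite ?mul1n.
  rewrite -big_mkcondr /=; case: ltnP => jh.
    by rewrite big1 ?addn0 // => i /andP[hi /eqP ij]; move: jh hi; rewrite ij; lia.
  rewrite (big_pred1 j) // => i /=; case: eqP => [->|_]; rewrite ?andbF //.
  by rewrite jh.
apply: monic_leadD.
  exists 'X_[m0]; last by rewrite mleadXm mcoeffX eqxx.
  apply: (subalg_genS (S := Mstar h B)); first by left.
  apply: Mstar_generates => //.
    by apply/supportedP=> i hi; rewrite mnmE ltnNge hi.
  by rewrite -chim; apply: eq_bigr => i ih; rewrite mnmE ih.
apply: big_ind => [||i hi]; [exact: monic_lead0 | exact: monic_leadD |].
have [hti | iht] := leqP (h + t) i.
  apply: monic_leadMn; exists 'X_i; last by rewrite mleadXm mcoeffX eqxx.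
  by apply: SubalgGen; right; right; exists i.
have [iht1 | iht1] := eqVneq i.+1 (h + t)%N.
  have /dvdnP[q ->] := pm i hi iht1.
  have -> : (U_(i) *+ (q * p) = U_(i) *+ p *+ q)%MM.
    by apply/mnmP=> j; rewrite !mulmnE mulnA mulnAC.
  apply/monic_leadMn/(@monic_lead_sub _ _ _ _ U_(i)).
    by apply: lt_mdeg_ltmc; rewrite mdegMn mdeg1 mul1n.
  right; left; right; exists i; rewrite mpolyXn; split=> //; lia.
have jn : (i.+1 < n)%N by lia.
(* In equal degree, the variable with the smaller index is the larger monomial. *)
apply/monic_leadMn/(@monic_lead_sub _ _ _ _ U_(Ordinal jn)).
  apply/ltmcP; rewrite ?mdeg1 //; exists i => [j ji|].
    by rewrite !mnm1E -!val_eqE /=; lia.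
  by rewrite !mnm1E eqxx -val_eqE /=; lia.
right; left; left; exists i, (Ordinal jn); split=> //=; lia.
Qed.

(** * The proposed generators generate the invariant ring *)

Lemma GL2_aff_neq0 (F : finFieldType) (M : {'GL_2[F]}) :
  M \in aff F -> M 0 0 != 0.
Proof.
rewrite inE => /andP[/eqP M10 _]; apply: contraNneq (GL_det M) => M00.
rewrite (expand_det_col _ 0); apply/eqP; apply: big1 => i _.
suff -> : M i 0 = 0 by rewrite mul0r.
have [-> // | i0] := eqVneq i 0.
suff -> : i = 1 by [].
by apply/val_inj; move: i i0 => [[|[|i]] lti].
Qed.

Lemma of_type_entries (F : finFieldType) (n h t : nat)
    (A : {dffun 'I_n -> {'GL_2[F]}}) :
  of_type h t A ->
  [/\ forall i : 'I_n, (i < h)%N -> A i 0 0 != 0,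
      forall i : 'I_n, (h <= i)%N -> A i 0 0 = 1,
      forall i : 'I_n, (h <= i < h + t)%N -> A i 0 1 = 1
    & forall i : 'I_n, (i < h)%N || (h + t <= i)%N -> A i 0 1 = 0].
Proof.
move=> [_ Ah At A1]; split=> i.
- by case/Ah=> /GL2_aff_neq0.
- move=> hi; have [iht | /A1 ->] := ltnP i (h + t); last by rewrite GL_1E mxE.
  by case: (At i _); rewrite ?hi.
- by case/At.
- by case/orP=> [/Ah[] | /A1 ->]; rewrite // GL_1E mxE.
Qed.

(** Monomials of [Mstar] are scaled by their character, which is 1. Differences of translated
    variables lose the common shift, and in [x ^ p - x] the shift cancels because Frobenius is
    additive. *)
Lemma candidate_invariant (F : finFieldType) (p n h t : nat)
    (A B : {dffun 'I_n -> {'GL_2[F]}}) (f : {mpoly F[n]}) :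
  p \in [pchar F] -> of_type h t A ->
  (forall i : 'I_n, (i < h)%N -> B i = A i) ->
  candidate p h t B f -> invariant_ring A f.
Proof.
move=> pF /of_type_entries[_ a1 b1 b0] BA; rewrite /invariant_ring /subst_act.
set lq := [tuple _ | i < n].
have XE (i : 'I_n) : 'X_i \mPo lq = A i 0 0 *: 'X_i + (A i 0 1)%:MP.
  by rewrite comp_mpolyXU -tnth_nth tnth_mktuple.
have XtE (i : 'I_n) : (h <= i < h + t)%N -> 'X_i \mPo lq = 'X_i + 1.
  by move=> it; rewrite XE a1 ?b1 ?scale1r ?mpolyC1 //; case/andP: it.
move=> [[[m [-> _ hm _ chim]] _] | [[[i [j [hi ji jt ->]]] | [i [t0 it ->]]] | [i hi ->]]].
- rewrite comp_mpolyX (eq_bigr (fun i => (A i 0 0) ^+ m i *: 'X_i ^+ m i)).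
    rewrite scaler_prod -mpolyXE_id -[RHS]scale1r -[X in _ = X *: _]chim.
    congr (_ *: _); rewrite [RHS]big_mkcond; apply: eq_bigr => i _.
    by case: ltnP => [/BA -> //|/a1 ->]; rewrite expr1n.
  move=> i _; rewrite tnth_mktuple; have [ih | hi] := ltnP i h.
    by rewrite b0 ?ih // addr0 exprZn.
  by rewrite hm // !expr0 scale1r.
- rewrite comp_mpolyB !XtE; [by rewrite opprD addrACA subrr addr0 | lia | lia].
- have pFX : p \in [pchar {mpoly F[n]}].
    rewrite inE (pcharf_prime pF) -mpolyC_nat (pcharf0 pF) mpolyC0; exact: eqxx.
  rewrite comp_mpolyB rmorphXn /= XtE; last by lia.
  rewrite -(pFrobenius_autE pFX) pFrobenius_autD_comm; last exact: commr1.
  by rewrite !pFrobenius_autE expr1n opprD addrACA subrr addr0.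
- by rewrite XE a1 ?b0 ?hi ?orbT ?scale1r ?addr0 //; lia.
Qed.

Lemma candidate_generates (F : finFieldType) (p n h t : nat)
    (A B : {dffun 'I_n -> {'GL_2[F]}}) :
  p \in [pchar F] -> of_type h t A ->
  (forall i : 'I_n, (i < h)%N -> B i = A i) ->
  generates (candidate p h t B) (invariant_ring A).
Proof.
move=> pF htA BA; have [ha a1 b1 b0] := of_type_entries htA.
have htn : (h + t <= n)%N by case: htA.
have invB : forall f g, invariant_ring A f -> invariant_ring A g ->
    forall c, invariant_ring A (f - c *: g).
  move=> f g fA gA c.
  by rewrite /invariant_ring /subst_act comp_mpolyB comp_mpolyZ; congr (_ - _ *: _).
have gen_inv f : subalg_gen (candidate p h t B) f -> invariant_ring A f.
  elim=> {f} [f | c | f g _ fA _ gA | f g _ fA _ gA].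
  - exact: candidate_invariant pF htA BA.
  - by rewrite alg_mpolyC /invariant_ring /subst_act comp_mpolyC.
  - by rewrite /invariant_ring /subst_act comp_mpolyD; congr (_ + _).
  - by rewrite /invariant_ring /subst_act rmorphM; congr (_ * _).
move=> f; split; last exact: gen_inv.
elim/mleadrect: f => f IHf fA.
have [-> | f_neq0] := eqVneq f 0.
  by rewrite -(scale0r 1); apply: SubalgScalar.
have [|||||e Se [em e1]] := @candidate_monic_lead F p n h t B (mlead f).
- exact/prime_gt1/(pcharf_prime pF).
- by [].
- by move=> i ih; rewrite BA ?ha.
- rewrite -(invariant_mlead_character a1 fA f_neq0).
  by apply: eq_bigr => i ih; rewrite BA.
- move=> k hk kt; apply: (invariant_mlead_dvd pF a1 hk _ _ fA f_neq0).
    by apply: b1; lia.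
  by move=> i ki; apply: b0; lia.
have -> : f = (f - f@_(mlead f) *: e) + f@_(mlead f) *: e by rewrite subrK.
apply: SubalgAdd; last exact: subalg_genZ.
(* The zero polynomial has leading monomial [0%MM], which is not strictly smaller when [f] is
   constant, so this case stays outside the induction. *)
have [-> | g_neq0] := eqVneq (f - f@_(mlead f) *: e) 0.
  by rewrite -(scale0r 1); apply: SubalgScalar.
apply: IHf; last by apply: invB => //; apply: gen_inv.
(* Both terms have leading monomial at most that of [f], and the coefficient there cancels. *)
rewrite lt_neqAle; apply/andP; split.
  apply: contraNneq g_neq0 => gm.
  by rewrite -mleadc_eq0 gm mcoeffB mcoeffZ e1 mulr1 subrr.
rewrite (le_trans (mleadB_le _ _)) // leUx lexx /=.
by rewrite (le_trans (mleadZ_le _ _)) // em.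
Qed.

(** * Irredundance of the generators *)

Lemma sum_mcoeffXU (R : nzRingType) (n : nat) (P : pred 'I_n) (i : 'I_n) :
  \sum_(j | P j) ('X_i : {mpoly R[n]})@_U_(j) = (P i)%:R.
Proof.
rewrite big_mkcond (bigD1 i) //= mcoeffXU eqxx big1 ?addr0; first by case: (P i).
by move=> j ji; rewrite mcoeffXU eq_sym (negPf ji) if_same.
Qed.

Lemma sum_mcoeffXUn (R : nzRingType) (n p : nat) (P : pred 'I_n) (i : 'I_n) :
  (1 < p)%N -> \sum_(j | P j) ('X_i ^+ p : {mpoly R[n]})@_U_(j) = 0.
Proof.
move=> p_gt1; apply: big1 => j _; rewrite mcoeffXn.
by case: eqP => // /(congr1 mdeg); rewrite mdegMn !mdeg1; lia.
Qed.

(** Linear monomials are indecomposable among all monomials, so [Q] can be trivial. Elements of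
    [Mstar] contribute nothing, since they involve only variables below [h] while [P] lies at or
    above [h]. *)
Lemma not_subalg_gen_linear (F : finFieldType) (p n h t : nat)
    (B : {dffun 'I_n -> {'GL_2[F]}}) (P : pred 'I_n)
    (T : {mpoly F[n]} -> Prop) (s : {mpoly F[n]}) :
  (forall i, P i -> (h <= i)%N) ->
  (forall f, T f -> candidate p h t B f) ->
  (forall f, T f -> Lset p h t f \/ Vset (h + t) f ->
     \sum_(j | P j) f@_U_(j) = 0) ->
  \sum_(j | P j) s@_U_(j) != 0 -> ~ subalg_gen T s.
Proof.
move=> Ph TS T0 s_neq0 Ts; case/eqP: s_neq0.
have [|||| _ -> //] := @subalg_gen_indecomposable F n T predT 'I_n (index_enum _)
  P (fun j => U_(j)%MM) isT _ _ _ _ s Ts.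
- by [].
- by move=> i _; rewrite mnm1_eq0.
- move=> i u v _ /(congr1 mdeg); rewrite mdeg1 mdegD => duv _ _.
  have [/eqP|/eqP] : mdeg u = 0%N \/ mdeg v = 0%N by lia.
    by rewrite mdeg_eq0 => /eqP; left.
  by rewrite mdeg_eq0 => /eqP; right.
- move=> g Tg; split=> //; case: (TS g Tg) => [[[m [gm _ hm _ _]] _] | /(T0 g Tg) //].
  apply: big1 => j Pj; rewrite gm mcoeffX; case: eqP => // mj.
  by have := hm j (Ph j Pj); rewrite mj mnm1E eqxx.
Qed.

(** The functional is the coefficient at the monomial [m] of [s]. A factorization of [m] within [Q]
    consists of invariant monomials in the first [h] variables that inherit the exponent bounds, so
    minimality of [m] makes one factor trivial. *)
Lemma not_subalg_gen_Mstar (F : finFieldType) (p n h t : nat)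
    (B : {dffun 'I_n -> {'GL_2[F]}}) (T : {mpoly F[n]} -> Prop)
    (s : {mpoly F[n]}) :
  (1 < p)%N -> (forall f, T f -> candidate p h t B f) ->
  Mstar h B s -> ~ T s -> ~ subalg_gen T s.
Proof.
move=> p_gt1 TS [[m [sm m_neq0 hm dm chim]] minm] nTs Ts.
pose chi := character h (fun i => B i 0 0).
(* Monomials involving a variable of index at least [h] are unrestricted, which admits all those of
   [Lset] and [Vset]. *)
pose Q u := supported h u ==> (chi u == 1).
have Q0 : Q 0%MM by rewrite /Q /chi character0 eqxx implybT.
have QD u v : Q u -> Q v -> Q (u + v)%MM.
  rewrite /Q /chi supportedD characterD.
  case: (supported h u) => //=; case: (supported h v) => //=.
  by move=> /eqP-> /eqP->; rewrite mulr1.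
have [|||_] := @subalg_gen_indecomposable F n T Q unit [:: tt] predT
  (fun _ => m) Q0 QD _ _ _ s Ts.
- by [].
- move=> _ u v _ muv Qu Qv; have [v0 | v_neq0] := eqVneq v 0%MM; [by right | left].
  have : supported h m by apply/supportedP.
  rewrite muv supportedD => /andP[hu hv].
  have vm : (v <= m)%MM by rewrite muv lem_addl.
  have Mv : Mset h B ('X_[v] : {mpoly F[n]}).
    apply/Mset_mpolyX; split=> //; last by apply/eqP; move: Qv; rewrite /Q hv.
    by move=> i ih; apply: leq_trans (dm i ih); apply/mnm_lepP.
  have /mpolyX_inj vE : 'X_[v] = 'X_[m] :> {mpoly F[n]}.
    by rewrite -sm; apply: minm => //; rewrite sm; apply/mpolyX_dvd.
  have : (u + v = 0 + v)%MM by rewrite -muv add0m.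
  by move/(congr1 (fun w => w - v)%MM); rewrite !addmK.
- move=> g Tg; rewrite big_seq1.
  have gs : g <> s by move=> gs; apply: nTs; rewrite -gs.
  have XU (i : 'I_n) q u : (h <= i)%N -> (0 < q)%N -> supported h u ->
      ('X_i ^+ q : {mpoly F[n]})@_u = 0.
    move=> hi q_gt0 /supportedP/(_ i hi) ui; rewrite mcoeffXn; case: eqP => // uE.
    by move: ui; rewrite -uE mulmnE mnm1E eqxx; lia.
  (* Every monomial of such a generator involves a variable of index at least [h]. *)
  have LV0 u : Lset p h t g \/ Vset (h + t) g -> supported h u -> g@_u = 0.
    move=> LV hu; case: LV => [[[i [j [hi ji _ ->]]] | [i [t0 it ->]]] | [i hi ->]].
    - by rewrite mcoeffB -['X_i]expr1 -['X_j]expr1 !XU ?subr0 //; lia.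
    - by rewrite mcoeffB -{2}['X_i]expr1 !XU ?subr0 //; lia.
    - by rewrite -['X_i]expr1 XU //; lia.
  case: (TS g Tg) => [[[m' [gm' _ _ _ chim']] _] | LV].
    split=> [u|]; rewrite gm' mcoeffX.
      case: (eqVneq m' u) => [<- _|_]; last by rewrite eqxx.
      by apply/implyP=> _; apply/eqP.
    by case: eqP => // m'm; case: gs; rewrite gm' m'm sm.
  split; last by apply: LV0 => //; apply/supportedP.
  by move=> u gu; apply/implyP=> /(LV0 u LV) gu0; rewrite gu0 eqxx in gu.
by rewrite big_seq1 sm mcoeffX eqxx => /eqP; rewrite oner_eq0.
Qed.

Lemma candidate_irredundant (F : finFieldType) (p n h t : nat)
    (B : {dffun 'I_n -> {'GL_2[F]}}) (T : {mpoly F[n]} -> Prop)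
    (s : {mpoly F[n]}) :
  (1 < p)%N -> (forall f, T f -> candidate p h t B f) ->
  candidate p h t B s -> ~ T s -> ~ subalg_gen T s.
Proof.
move=> p_gt1 TS Ss nTs Ts.
have neq_s f : T f -> f <> s by move=> Tf fs; apply: nTs; rewrite -fs.
have diffE (P : pred 'I_n) (i j : 'I_n) :
    \sum_(l | P l) ('X_i - 'X_j : {mpoly F[n]})@_U_(l) = (P i)%:R - (P j)%:R.
  by under eq_bigr do rewrite mcoeffB; rewrite sumrB !sum_mcoeffXU.
have powE (P : pred 'I_n) (i : 'I_n) :
    \sum_(l | P l) ('X_i ^+ p - 'X_i : {mpoly F[n]})@_U_(l) = - (P i)%:R.
  by under eq_bigr do rewrite mcoeffB; rewrite sumrB sum_mcoeffXUn // sum_mcoeffXU sub0r.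
case: Ss => [Ms | [[[i [j [hi ji jt sE]]] | [i [t0 it sE]]] | [i hi sE]]].
- exact: (not_subalg_gen_Mstar p_gt1 TS Ms nTs Ts).
(* This initial segment of the translated block ends between [i] and [j]: every other difference has
   both or neither of its variables in it, and the remaining generators of [Lset] and [Vset] have no
   linear term there. *)
- pose P := [pred l : 'I_n | (h <= l <= i)%N].
  apply: (@not_subalg_gen_linear F p n h t B P T s _ TS _ _ Ts).
  + by move=> l /andP[].
  + move=> f /neq_s; rewrite sE.
    move=> fs [[[i' [j' [hi' ji' jt' fE]]] | [i' [_ it' fE]]] | [i' hi' fE]]; rewrite fE.
    * rewrite diffE; suff -> : P i' = P j' by rewrite subrr.
      have ii' : i' != i.
        apply: contra_notN fs => /eqP ii'; rewrite fE ii'; congr (_ - 'X_ _).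
        by apply/val_inj; rewrite /= ji ji' ii'.
      by move: ii'; rewrite -val_eqE /= ji'; lia.
    * rewrite powE; suff /negPf-> : ~~ P i' by rewrite oppr0.
      by rewrite /P /=; lia.
    * rewrite sum_mcoeffXU; suff /negPf-> : ~~ P i' by [].
      by rewrite /P /=; lia.
  + rewrite sE diffE; have -> : P i by rewrite /P /= hi leqnn.
    have /negPf-> : ~~ P j by rewrite /P /=; lia.
    by rewrite subr0 oner_neq0.
(* Here [i] ends the translated block, so [P] is the whole block. All differences sum to zero on it,
   while [x_i ^ p - x_i] gives -1. *)
- pose P := [pred l : 'I_n | (h <= l <= i)%N].
  apply: (@not_subalg_gen_linear F p n h t B P T s _ TS _ _ Ts).
  + by move=> l /andP[].
  + move=> f /neq_s; rewrite sE.
    move=> fs [[[i' [j' [hi' ji' jt' fE]]] | [i' [_ it' fE]]] | [i' hi' fE]]; rewrite fE.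
    * rewrite diffE; suff -> : P i' = P j' by rewrite subrr.
      by rewrite /P /=; lia.
    * case: fs; rewrite fE; suff -> : i' = i by [].
      by apply/val_inj => /=; lia.
    * rewrite sum_mcoeffXU; suff /negPf-> : ~~ P i' by [].
      by rewrite /P /=; lia.
  + rewrite sE powE; have -> : P i by rewrite /P /= leqnn; lia.
    by rewrite oppr_eq0 oner_neq0.
(* Beyond the translated block each variable occurs in a single generator, so its own coefficient
   separates it. *)
- apply: (@not_subalg_gen_linear F p n h t B (pred1 i) T s _ TS _ _ Ts).
  + by move=> l /eqP->; lia.
  + move=> f /neq_s; rewrite sE.
    move=> fs [[[i' [j' [hi' ji' jt' fE]]] | [i' [_ it' fE]]] | [i' hi' fE]]; rewrite fE.
    * by rewrite diffE /= -!val_eqE /= !ltn_eqF ?subrr //; lia.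
    * by rewrite powE /= -val_eqE /= ltn_eqF ?oppr0 //; lia.
    * rewrite sum_mcoeffXU /=; case: eqP => // ii'.
      by case: fs; rewrite fE ii'.
  + by rewrite sE sum_mcoeffXU /= eqxx oner_neq0.
Qed.

Local Close Scope ring_scope.

Theorem proposition3p5 (F : finFieldType) (p : nat) (charFp : p \in [pchar F]%R)
    (n : nat) (n_gt0 : 0 < n) (h t : nat)
    (A A1 A2 : {dffun 'I_n -> {'GL_2[F]}}) :
  A \in affn F n ->
  of_type h t A ->
  canonical_decomposition h A A1 A2 ->
  minimal_generating_set
    (fun f : {mpoly F[n]} => Mstar h A1 f \/ Lset p h t f \/ Vset (h + t) f)
    (invariant_ring A).
Proof.
move=> _ htA [A1E _].
have A1A (i : 'I_n) : i < h -> A1 i = A i by rewrite A1E ffunE => ->.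
have gen := candidate_generates charFp htA A1A.
split=> // T [TS [s Ss nTs]] genT.
(* The omitted generator [s] is invariant, so a generating [T] would produce it. *)
apply: (candidate_irredundant (prime_gt1 (pcharf_prime charFp)) TS Ss nTs).
by apply/genT/gen/SubalgGen.
Qed.
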